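(* Let $B\in\mathbb{R}^{d\times d}$ and $R\in\mathbb{R}^{m\times m}$ be symmetric positive definite, let $H\in\mathbb{R}^{m\times d}$, and set $G := H^\top R^{-1} H\succeq 0$ and $A := B^{-1}+G$. Let $\alpha_t=1-t$ and $\beta_t^2=t$ for $t\in[0,1]$, and let $h:[0,1]\to\mathbb{R}$ be a decreasing damping function satisfying $h(0)=1$ and $h(1)=0$. Define $$\Sigma_t := \alpha_t^2 B+\beta_t^2 I,\qquad A_t^{\mathrm{EnSF}} := \Sigma_t^{-1}+h(t)\,H^\top R^{-1}H .$$ Let $b_{\max}\ge b_{\min}>0$ denote the largest and smallest eigenvalues of $B$. Then $A_t^{\mathrm{EnSF}}$ has the following properties: (1) (Endpoint consistency) $A_0^{\mathrm{EnSF}} = B^{-1}+H^\top R^{-1}H = A$ and $A_1^{\mathrm{EnSF}} = I$, so the curvature path $A_t^{\mathrm{EnSF}}$ connects the same reference geometry ($I$, at $t=1$) and target geometry ($A$, at $t=0$) as the exact path $A_t^\star := (\alpha_t^2A^{-1}+\beta_t^2 I)^{-1}$. (2) (Two-sided spectral bounds) $$\Sigma_t^{-1}+h(t)\lambda_{\min}(G)\,I\;\preceq\; A_t^{\mathrm{EnSF}}\;\preceq\;\Sigma_t^{-1}+h(t)\lambda_{\max}(G)\,I,$$ and hence every eigenvalue $\lambda_i(A_t^{\mathrm{EnSF}})$ of $A_t^{\mathrm{EnSF}}$ satisfies $$\frac{1}{\alpha_t^2b_{\max}+\beta_t^2}+h(t)\,\lambda_{\min}(G)\;\le\;\lambda_i\!\left(A_t^{\mathrm{EnSF}}\right)\;\le\;\frac{1}{\alpha_t^2b_{\min}+\beta_t^2}+h(t)\,\lambda_{\max}(G).$$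 (3) (Condition-number bound) $$\kappa\!\left(A_t^{\mathrm{EnSF}}\right)\;\le\;\kappa(\Sigma_t)+h(t)\,\lambda_{\max}(G)\left(\alpha_t^2b_{\max}+\beta_t^2\right),\qquad \kappa(\Sigma_t)=\frac{\alpha_t^2b_{\max}+\beta_t^2}{\alpha_t^2b_{\min}+\beta_t^2}\le\kappa(B),$$ so that $\kappa(A_t^{\mathrm{EnSF}})\to 1$ as $t\to1$, meaning that the reverse transport (which runs from $t=1$ to $t=0$) starts on a near-isotropic geometry regardless of how anisotropic the prior is and how informative the observation is.
   Context: For a symmetric matrix $M$, $\lambda_{\max}(M)$ and $\lambda_{\min}(M)$ denote its largest and smallest eigenvalues; for symmetric positive definite $M$, $\kappa(M)=\lambda_{\max}(M)/\lambda_{\min}(M)$. $M\preceq N$ denotes the Loewner order ($N-M$ is positive semidefinite). $I$ is the $d\times d$ identity matrix. $B$ is the prior (background) covariance, $R$ the observation-error covariance, $H$ the linear observation operator, and $A$ the posterior curvature (precision matrix of the Gaussian posterior). $t\in[0,1]$ is a pseudo-time: $t=0$ corresponds to the target posterior and $t=1$ to the standard Gaussian reference, and posterior samples are generated by reverse transport from $t=1$ to $t=0$. $A_t^{\mathrm{EnSF}}$ is the curvature matrix induced by the ensemble score filter (EnSF), i.e. the matrix for which the EnSF posterior score is $-A_t^{\mathrm{EnSF}}z+h(t)H^\top R^{-1}d_{\mathrm{obs}}$, where $z\in\mathbb{R}^d$ is the state increment and $d_{\mathrm{obs}}\in\mathbb{R}^m$ is the innovation (observation minus observed prior mean). $A_t^\star$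 is the curvature (inverse covariance) of the exactly diffused Gaussian posterior.
   Formalization: The limit κ(A_t^EnSF)→1 as t→1 is proved under the added assumption that h(t)→0 as t→1 from the left (h continuous at 1); without it the limit fails, e.g. for h(t)=1−t/2 on [0,1), h(1)=0 and G not a multiple of I. The case d=0 is excluded. *)

(* Defs.v *)
From HB Require Import structures.
From mathcomp Require Export all_boot all_order all_algebra.
From mathcomp Require Export sesquilinear.
From mathcomp Require Export boolp classical_sets reals topology normedtype.

Set Implicit Arguments.
Unset Strict Implicit.
Unset Printing Implicit Defensive.

Export Order.TTheory GRing.Theory Num.Theory.
Export numFieldNormedType.Exports.

Local Open Scope classical_set_scope.
Local Open Scope ring_scope.

Definition quadform (K : realType) (d : nat) (M : 'M[K]_d) (x : 'cV[K]_d) : K :=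
  (x^T *m M *m x) 0 0.

Definition spdmx (K : realType) (d : nat) (M : 'M[K]_d) : Prop :=
  M \is symmetricmx /\ forall x : 'cV[K]_d, x != 0 -> 0 < quadform M x.

Definition psdmx (K : realType) (d : nat) (M : 'M[K]_d) : Prop :=
  M \is symmetricmx /\ forall x : 'cV[K]_d, 0 <= quadform M x.

Definition loewner_le (K : realType) (d : nat) (M N : 'M[K]_d) : Prop :=
  psdmx (N - M).

(* The spectrum of a symmetric matrix of positive size is finite and nonempty,
   so that the supremum and infimum below are a maximum and a minimum.  For the
   0 x 0 matrix, which has no eigenvalue, both take the junk value 0. *)
Definition lambda_max (K : realType) (d : nat) (M : 'M[K]_d) : K :=
  sup [set a | eigenvalue M a].

Definition lambda_min (K : realType) (d : nat) (M : 'M[K]_d) : K :=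
  inf [set a | eigenvalue M a].

Definition cond_number (K : realType) (d : nat) (M : 'M[K]_d) : K :=
  lambda_max M / lambda_min M.

Definition alpha (K : realType) (t : K) : K := 1 - t.

(* beta_t enters only through its square beta_t ^ 2 = t. *)
Definition beta_sq (K : realType) (t : K) : K := t.

(* The damping function h : [0, 1] -> K is a total function constrained only on
   [0, 1].  "Decreasing" is taken in the weak sense, which covers the strict
   one. *)
Definition damping (K : realType) (h : K -> K) : Prop :=
  [/\ {in `[0, 1] &, {homo h : s t / s <= t >-> t <= s}}, h 0 = 1 & h 1 = 0].

Definition obs_info (K : realType) (d m : nat)
    (R : 'M[K]_m) (H : 'M[K]_(m, d)) : 'M[K]_d :=
  H^T *m invmx R *m H.

Definition post_curv (K : realType) (d m : nat)
    (B : 'M[K]_d) (R : 'M[K]_m) (H : 'M[K]_(m, d)) : 'M[K]_d :=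
  invmx B + obs_info R H.

Definition Sigma (K : realType) (d : nat) (B : 'M[K]_d) (t : K) : 'M[K]_d :=
  alpha t ^+ 2 *: B + beta_sq t *: 1%:M.

Definition A_EnSF (K : realType) (d m : nat)
    (B : 'M[K]_d) (R : 'M[K]_m) (H : 'M[K]_(m, d)) (h : K -> K) (t : K) :
    'M[K]_d :=
  invmx (Sigma B t) + h t *: (H^T *m invmx R *m H).

Definition A_star (K : realType) (d m : nat)
    (B : 'M[K]_d) (R : 'M[K]_m) (H : 'M[K]_(m, d)) (t : K) : 'M[K]_d :=
  invmx (alpha t ^+ 2 *: invmx (post_curv B R H) + beta_sq t *: 1%:M).

(* Main.v *)
Require Import Defs.
From mathcomp Require Import ring lra.

(** Everything follows from the variational description of the extreme
eigenvalues of a symmetric matrix: the quadratic form of [M] lies between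
[lambda_min M] and [lambda_max M] times the squared norm, and both constants
are eigenvalues.  Once this is known, an eigenvalue of [M] is bounded by any
constant that bounds the quadratic form, so eigenvalue estimates for a sum
reduce to adding inequalities between quadratic forms.

The variational description ([lambda_maxP]) is proved without the spectral
theorem or compactness of the sphere.  Let [s] be the least constant such that
the form of [M] is at most [s] times the squared norm.  Then [N = s I - M] is
positive semidefinite.  If [N] were invertible, the Cauchy-Schwarz inequality
for [N], applied to [x] and [N^-1 x], would bound the form of [N] below by a
positive multiple of the squared norm ([psd_unit_coercive]), and [s] could be
lowered.  Hence [N] is singular, that is, [s] is an eigenvalue of [M].

For a positive definite [S] the eigenvalues of [S^-1] lie between
[1 / lambda_max S] and [1 / lambda_min S].  Adding the form of [a G], with
[0 <= a], gives the two-sided bounds on [S^-1 + a G]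
([quadform_invmx_addZ]).  Since [lambda_min (S^-1 + a G)] is at least
[1 / lambda_max S] when [G] is positive semidefinite, dividing the upper bound
by it yields the condition number estimate ([cond_number_invmx_addZ]).  The
theorem is the case [S = Sigma_t], whose extreme eigenvalues are affine
functions of those of [B].  As [t] tends to 1 from the left, these eigenvalues
tend to 1 and [h t] tends to 0, so the condition number is squeezed between 1
and a bound that tends to 1. *)

Local Open Scope classical_set_scope.
Local Open Scope ring_scope.

Set Implicit Arguments.
Unset Strict Implicit.
Unset Printing Implicit Defensive.

(** * Quadratic forms *)

Definition bilform (K : realType) (d : nat) (M : 'M[K]_d)
    (x y : 'cV[K]_d) : K :=
  (x^T *m M *m y) 0 0.

Definition normsq (K : realType) (d : nat) (x : 'cV[K]_d) : K :=
  quadform 1%:M x.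

Lemma symmetricmxP (K : realType) (d : nat) (M : 'M[K]_d) :
  M \is symmetricmx <-> M^T = M.
Proof.
rewrite is_hermitianmxE expr0 scale1r map_mx_id //.
by split=> [/eqP <-|->].
Qed.

Lemma quadformD (K : realType) d (M N : 'M[K]_d) x :
  quadform (M + N) x = quadform M x + quadform N x.
Proof. by rewrite /quadform mulmxDr mulmxDl mxE. Qed.

Lemma quadformZ (K : realType) d a (M : 'M[K]_d) x :
  quadform (a *: M) x = a * quadform M x.
Proof. by rewrite /quadform -scalemxAr -scalemxAl mxE. Qed.

Lemma quadformN (K : realType) d (M : 'M[K]_d) x :
  quadform (- M) x = - quadform M x.
Proof. by rewrite -scaleN1r quadformZ mulN1r. Qed.

Lemma quadform0 (K : realType) d (M : 'M[K]_d) : quadform M 0 = 0.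
Proof. by rewrite /quadform mulmx0 mxE. Qed.

Lemma quadform_scalar (K : realType) d (a : K) (x : 'cV[K]_d) :
  quadform (a *: 1%:M) x = a * normsq x.
Proof. by rewrite quadformZ. Qed.

Lemma normsqE (K : realType) d (x : 'cV[K]_d) :
  normsq x = \sum_i x i 0 ^+ 2.
Proof.
by rewrite /normsq /quadform mulmx1 mxE; apply: eq_bigr => i _; rewrite mxE.
Qed.

Lemma normsq_ge0 (K : realType) d (x : 'cV[K]_d) : 0 <= normsq x.
Proof. by rewrite normsqE; apply: sumr_ge0 => i _; rewrite sqr_ge0. Qed.

Lemma normsq_eq0 (K : realType) d (x : 'cV[K]_d) : (normsq x == 0) = (x == 0).
Proof.
apply/idP/idP=> [|/eqP ->]; last first.
  by rewrite normsqE big1 // => i _; rewrite mxE expr0n.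
rewrite normsqE psumr_eq0 => [|i _]; last exact: sqr_ge0.
move=> /allP x0; apply/eqP/matrixP=> i j; rewrite ord1 mxE.
by apply/eqP; rewrite -sqrf_eq0; apply: x0; rewrite mem_index_enum.
Qed.

Lemma normsq_gt0 (K : realType) d (x : 'cV[K]_d) : (0 < normsq x) = (x != 0).
Proof. by rewrite lt0r normsq_ge0 andbT normsq_eq0. Qed.

Lemma bilform_sym (K : realType) d (M : 'M[K]_d) x y :
  M \is symmetricmx -> bilform M y x = bilform M x y.
Proof.
move=> /symmetricmxP Msym.
have -> : bilform M x y = (x^T *m M *m y)^T 0 0 by rewrite mxE.
by rewrite !trmx_mul trmxK Msym mulmxA.
Qed.

Lemma quadformDZ (K : realType) d (M : 'M[K]_d) s x y : M \is symmetricmx ->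
  quadform M (x + s *: y) =
  quadform M x + 2 * s * bilform M x y + s ^+ 2 * quadform M y.
Proof.
move=> Msym; have := bilform_sym x y Msym; rewrite /bilform /quadform => yx.
have entryD (P Q : 'M[K]_1) : (P + Q) 0 0 = P 0 0 + Q 0 0 by rewrite mxE.
have entryZ a (P : 'M[K]_1) : (a *: P) 0 0 = a * P 0 0 by rewrite mxE.
have -> : (x + s *: y)^T = x^T + s *: y^T by rewrite linearD linearZ.
rewrite !mulmxDl !mulmxDr -!scalemxAl -!scalemxAr.
by rewrite !(entryD, entryZ) yx; ring.
Qed.

(** As for a scalar product, the form of [N] is nonnegative on the whole line
[x + s y]; since [N] may be degenerate, the case where it vanishes at [y] is
treated separately. *)
Lemma psd_cauchy_schwarz (K : realType) d (N : 'M[K]_d) x y : psdmx N ->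
  bilform N x y ^+ 2 <= quadform N x * quadform N y.
Proof.
move=> [Nsym Nge0]; have qx := Nge0 x; have qy := Nge0 y.
have disc s := Nge0 (x + s *: y).
have {}disc s : 0 <= quadform N x + 2 * s * bilform N x y + s ^+ 2 * quadform N y.
  by rewrite -quadformDZ.
have [b0|b0] := eqVneq (bilform N x y) 0.
  by rewrite b0 expr0n mulr_ge0.
have [y0|y0] := eqVneq (quadform N y) 0.
  (* Here the form is affine in [s]; this [s] gives it the value -1. *)
  have := disc (- (quadform N x + 1) / (2 * bilform N x y)).
  rewrite y0 mulr0 addr0.
  have -> : 2 * (- (quadform N x + 1) / (2 * bilform N x y)) * bilform N x y
    = - (quadform N x + 1) by field.
  lra.
have y_gt0 : 0 < quadform N y by rewrite lt0r y0.
(* The vertex of the parabola in [s]. *)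
have := disc (- bilform N x y / quadform N y).
have -> : quadform N x + 2 * (- bilform N x y / quadform N y) * bilform N x y +
   (- bilform N x y / quadform N y) ^+ 2 * quadform N y =
   (quadform N x * quadform N y - bilform N x y ^+ 2) / quadform N y by field.
by rewrite pmulr_lge0 ?invr_gt0 // subr_ge0.
Qed.

(** Any crude constant is enough: it provides a starting point for the infimum
in [max_eigenvalue] and bounds the form of an inverse in
[psd_unit_coercive]. *)
Lemma quadform_bounded (K : realType) d (M : 'M[K]_d) :
  exists2 C, 0 < C & forall x, `|quadform M x| <= C * normsq x.
Proof.
exists (1 + \sum_j \sum_i `|M i j|) => [|x].
  by rewrite ltr_pwDl // !sumr_ge0 // => j _; rewrite sumr_ge0.
have xij i j : `|x i 0| * `|x j 0| <= normsq x.
  have xn k : x k 0 ^+ 2 <= normsq x.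
    rewrite normsqE (bigD1 k) //= lerDl sumr_ge0 // => l _; exact: sqr_ge0.
  have := xn i; have := xn j; rewrite -(real_normK (num_real (x i 0))).
  rewrite -(real_normK (num_real (x j 0))).
  have := sqr_ge0 (`|x i 0| - `|x j 0|); rewrite sqrrB; lra.
have -> : quadform M x = \sum_j \sum_i x i 0 * M i j * x j 0.
  rewrite /quadform mxE; apply: eq_bigr => j _; rewrite mxE mulr_suml.
  by apply: eq_bigr => i _; rewrite mxE.
rewrite mulrDl mul1r ler_wpDl ?normsq_ge0 // mulr_suml.
apply: le_trans (ler_norm_sum _ _ _) _; apply: ler_sum => j _.
rewrite mulr_suml; apply: le_trans (ler_norm_sum _ _ _) _; apply: ler_sum => i _.
by rewrite !normrM (mulrC `|x i 0|) -mulrA ler_wpM2l.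
Qed.

(** The Cauchy-Schwarz inequality for [x] and [N^-1 x] reads
[normsq x ^ 2 <= quadform N x * quadform N^-1 x], and the last factor is at
most a constant times [normsq x].  This replaces the compactness of the unit
sphere. *)
Lemma psd_unit_coercive (K : realType) d (N : 'M[K]_d) :
  psdmx N -> N \in unitmx ->
  exists2 c, 0 < c & forall x, c * normsq x <= quadform N x.
Proof.
move=> Npsd Nu; have [C C_gt0 Cub] := quadform_bounded (invmx N).
have [/symmetricmxP Nsym _] := Npsd.
exists C^-1 => [|x]; first by rewrite invr_gt0.
have [->|x0] := eqVneq x 0.
  by rewrite /normsq !quadform0 mulr0.
have := psd_cauchy_schwarz x (invmx N *m x) Npsd.
have -> : bilform N x (invmx N *m x) = normsq x.
  by rewrite /bilform mulmxA mulmxK // /normsq /quadform mulmx1.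
have -> : quadform N (invmx N *m x) = quadform (invmx N) x.
  by rewrite /quadform trmx_mul trmx_inv Nsym mulmxA mulmxKV.
move=> cs; have x_gt0 : 0 < normsq x by rewrite normsq_gt0.
rewrite mulrC ler_pdivrMr // -(ler_pM2r x_gt0) -expr2.
apply: le_trans cs _; rewrite -mulrA.
apply: ler_wpM2l; first by case: Npsd.
exact: le_trans (ler_norm _) (Cub x).
Qed.

(** * Variational description of the extreme eigenvalues *)

Lemma eigenvalue_unit (K : realType) d (M : 'M[K]_d) a :
  eigenvalue M a = (a *: 1%:M - M \notin unitmx).
Proof.
rewrite /eigenvalue /eigenspace kermx_eq0 row_free_unit -opprB scalemx1.
by rewrite -scaleN1r unitmxZ // unitrN1.
Qed.

(** The witness is the least [c] for which the form is at most
[c * normsq x]: if [c I - M] were invertible it would be coercive, and a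
smaller constant would do.  Positive size makes the set of such constants
bounded below. *)
Lemma max_eigenvalue (K : realType) d (M : 'M[K]_d) : (0 < d)%N ->
  M \is symmetricmx ->
  exists2 s, eigenvalue M s & forall x, quadform M x <= s * normsq x.
Proof.
case: d M => // d M _ Msym.
pose E := [set c | forall x, quadform M x <= c * normsq x].
have [C C_gt0 Cub] := quadform_bounded M.
have E0 : E !=set0 by exists C => x; exact: le_trans (ler_norm _) (Cub x).
have Elb x : x != 0 -> lbound E (quadform M x / normsq x).
  by rewrite -normsq_gt0 => x0 c Ec /=; rewrite ler_pdivrMr.
have one0 : const_mx 1 != 0 :> 'cV[K]_d.+1.
  by apply/eqP => /matrixP /(_ 0 0) /eqP; rewrite !mxE oner_eq0.
have Einf : E (inf E).
  move=> x; have [->|x0] := eqVneq x 0.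
    by rewrite /normsq !quadform0 mulr0.
  rewrite -ler_pdivrMr ?normsq_gt0 //.
  exact: lb_le_inf E0 (Elb x x0).
exists (inf E) => //; rewrite eigenvalue_unit; apply/negP => Nu.
have Npsd : psdmx (inf E *: 1%:M - M).
  split=> [|x]; last by rewrite quadformD quadformN quadform_scalar subr_ge0.
  apply/symmetricmxP; rewrite linearB linearZ /= trmx1.
  by move/symmetricmxP: Msym => ->.
have [c c_gt0 coercive] := psd_unit_coercive Npsd Nu.
have : E (inf E - c).
  move=> x; have := coercive x.
  by rewrite quadformD quadformN quadform_scalar mulrBl; lra.
move=> /(ge_inf (ex_intro _ _ (Elb _ one0))); lra.
Qed.

(** [eigenvalue] speaks of row eigenvectors, the quadratic form of columns:
transposing the eigenvector passes from one to the other, for any square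
matrix. *)
Lemma eigenvalue_quadform (K : realType) d (M : 'M[K]_d) a : eigenvalue M a ->
  exists2 x : 'cV[K]_d, x != 0 & quadform M x = a * normsq x.
Proof.
move=> /eigenvalueP[v vM v0]; exists v^T.
  by apply: contra v0 => /eqP v0; rewrite -(trmxK v) v0 trmx0.
by rewrite /normsq /quadform trmxK vM mulmx1 -scalemxAl mxE.
Qed.

Lemma eigenvalue_le (K : realType) d (M : 'M[K]_d) c :
  (forall x, quadform M x <= c * normsq x) -> forall a, eigenvalue M a -> a <= c.
Proof.
move=> Mc a /eigenvalue_quadform[x x0 qx]; have := Mc x.
by rewrite qx ler_pM2r // normsq_gt0.
Qed.

Lemma eigenvalue_ge (K : realType) d (M : 'M[K]_d) c :
  (forall x, c * normsq x <= quadform M x) -> forall a, eigenvalue M a -> c <= a.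
Proof.
move=> Mc a /eigenvalue_quadform[x x0 qx]; have := Mc x.
by rewrite qx ler_pM2r // normsq_gt0.
Qed.

Lemma lambda_maxP (K : realType) d (M : 'M[K]_d) : (0 < d)%N ->
  M \is symmetricmx ->
  eigenvalue M (lambda_max M) /\
  forall x, quadform M x <= lambda_max M * normsq x.
Proof.
move=> d0 Msym; have [s sM Ms] := max_eigenvalue d0 Msym.
suff -> : lambda_max M = s by [].
have sub : ubound [set a | eigenvalue M a] s by move=> a /=; exact: eigenvalue_le.
apply/eqP; rewrite eq_le /lambda_max ge_sup //=; last by exists s.
by apply: ub_le_sup => //; exists s.
Qed.

Lemma eigenvalueN (K : realType) d (M : 'M[K]_d) a :
  eigenvalue (- M) (- a) = eigenvalue M a.
Proof.
rewrite !eigenvalue_unit scaleNr -opprD -(scaleN1r (_ - _)) unitmxZ //.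
exact: unitrN1.
Qed.

(** Carries every statement about [lambda_max] over to [lambda_min]. *)
Lemma lambda_minN (K : realType) d (M : 'M[K]_d) :
  lambda_min M = - lambda_max (- M).
Proof.
rewrite /lambda_min /lambda_max /inf; congr (- sup _).
apply/seteqP; split=> [_ [a Ma <-]|a Ma] /=; first by rewrite eigenvalueN.
by exists (- a); rewrite ?opprK //= -eigenvalueN opprK.
Qed.

Lemma symmetricmxN (K : realType) d (M : 'M[K]_d) :
  M \is symmetricmx -> - M \is symmetricmx.
Proof. by move=> /symmetricmxP e; apply/symmetricmxP; rewrite linearN /= e. Qed.

Lemma lambda_minP (K : realType) d (M : 'M[K]_d) : (0 < d)%N ->
  M \is symmetricmx ->
  eigenvalue M (lambda_min M) /\
  forall x, lambda_min M * normsq x <= quadform M x.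
Proof.
move=> d0 /symmetricmxN Nsym; have [ev ub] := lambda_maxP d0 Nsym.
rewrite lambda_minN; split=> [|x]; first by rewrite -eigenvalueN opprK.
by rewrite mulNr lerNl -quadformN.
Qed.

(** One inequality compares quadratic forms; for the other, an eigenvector of
[M] is also one of [a M + c I]. *)
Lemma lambda_max_affine (K : realType) d (M : 'M[K]_d) a c : (0 < d)%N ->
  M \is symmetricmx -> 0 <= a ->
  lambda_max (a *: M + c *: 1%:M) = a * lambda_max M + c.
Proof.
move=> d0 Msym a0; have [ev ub] := lambda_maxP d0 Msym.
have Nsym : a *: M + c *: 1%:M \is symmetricmx.
  apply/symmetricmxP; rewrite linearD !linearZ /= trmx1.
  by move/symmetricmxP: Msym => ->.
have [ev' ub'] := lambda_maxP d0 Nsym.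
apply/eqP; rewrite eq_le; apply/andP; split.
  apply: eigenvalue_le ev' => x; rewrite quadformD quadform_scalar quadformZ.
  by rewrite mulrDl lerD2r -mulrA ler_wpM2l.
apply: (eigenvalue_le ub'); move/eigenvalueP: ev => [v vM v0].
apply/eigenvalueP; exists v => //.
by rewrite mulmxDr -!scalemxAr vM mulmx1 scalerA scalerDl.
Qed.

Lemma lambda_min_affine (K : realType) d (M : 'M[K]_d) a c : (0 < d)%N ->
  M \is symmetricmx -> 0 <= a ->
  lambda_min (a *: M + c *: 1%:M) = a * lambda_min M + c.
Proof.
move=> d0 /symmetricmxN Msym a0.
by rewrite !lambda_minN opprD -scalerN -scaleNr lambda_max_affine //; ring.
Qed.

(** * Positive definite matrices and their inverses *)

Lemma spd_unit (K : realType) d (M : 'M[K]_d) : spdmx M -> M \in unitmx.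
Proof.
move=> [_ Mpos]; rewrite -row_free_unit -kermx_eq0; apply/negP => ker.
have [|v vM v0] := @eigenvalueP _ _ M 0 _.
  by rewrite /eigenvalue /eigenspace raddf0 subr0; apply/negP.
have /Mpos : v^T != 0 by apply: contra v0 => /eqP v0; rewrite -(trmxK v) v0 trmx0.
by rewrite /quadform trmxK vM scale0r mul0mx mxE ltxx.
Qed.

Lemma invmx_sym (K : realType) d (M : 'M[K]_d) :
  M \is symmetricmx -> invmx M \is symmetricmx.
Proof.
by move=> /symmetricmxP e; apply/symmetricmxP; rewrite trmx_inv e.
Qed.

Lemma invmx_spd (K : realType) d (M : 'M[K]_d) : spdmx M -> spdmx (invmx M).
Proof.
move=> Mspd; have Mu := spd_unit Mspd; have [Msym Mpos] := Mspd.
split=> [|x x0]; first exact: invmx_sym.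
have -> : quadform (invmx M) x = quadform M (invmx M *m x).
  rewrite /quadform trmx_mul trmx_inv; move/symmetricmxP: Msym => ->.
  by rewrite mulmxA mulmxKV.
apply: Mpos; apply: contra x0 => /eqP x0.
by rewrite -(mulKVmx Mu x) x0 mulmx0.
Qed.

Lemma spd_psd (K : realType) d (M : 'M[K]_d) : spdmx M -> psdmx M.
Proof.
move=> [Msym Mpos]; split=> // x; have [->|/Mpos/ltW //] := eqVneq x 0.
by rewrite quadform0.
Qed.

Lemma congruence_psd (K : realType) m d (M : 'M[K]_m) (H : 'M[K]_(m, d)) :
  psdmx M -> psdmx (H^T *m M *m H).
Proof.
move=> [/symmetricmxP Msym Mpos]; split=> [|x].
  by apply/symmetricmxP; rewrite !trmx_mul trmxK Msym mulmxA.
have := Mpos (H *m x); congr (_ <= _).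
by rewrite /quadform trmx_mul !mulmxA.
Qed.

Lemma spd_eigenvalue_gt0 (K : realType) d (M : 'M[K]_d) a :
  spdmx M -> eigenvalue M a -> 0 < a.
Proof.
move=> [_ Mpos] /eigenvalue_quadform[x x0 qx]; have := Mpos x x0.
by rewrite qx pmulr_lgt0 // normsq_gt0.
Qed.

(** An eigenvector of the inverse is one of [M], for the inverse eigenvalue. *)
Lemma eigenvalue_invmx (K : realType) d (M : 'M[K]_d) a : M \in unitmx ->
  a != 0 -> eigenvalue (invmx M) a -> eigenvalue M a^-1.
Proof.
move=> Mu a0 /eigenvalueP[v vM v0]; apply/eigenvalueP; exists v => //.
apply: (scalerI a0); rewrite scalerA divff // scale1r.
by rewrite scalemxAl -vM mulmxKV.
Qed.

(** The reciprocal of an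
eigenvalue of the inverse is an eigenvalue of [M], hence at most
[lambda_max M]. *)
Lemma lambda_min_invmx_ge (K : realType) d (M : 'M[K]_d) : (0 < d)%N ->
  spdmx M -> (lambda_max M)^-1 <= lambda_min (invmx M).
Proof.
move=> d0 Mspd; have [Isym Ipos] := invmx_spd Mspd.
have [ev _] := lambda_minP d0 Isym.
have a_gt0 := spd_eigenvalue_gt0 (invmx_spd Mspd) ev.
have [ev' ub] := lambda_maxP d0 Mspd.1.
have := eigenvalue_le ub (eigenvalue_invmx (spd_unit Mspd) (lt0r_neq0 a_gt0) ev).
by move=> le;
  rewrite -[leRHS]invrK lef_pV2 ?posrE ?invr_gt0 ?(spd_eigenvalue_gt0 Mspd ev').
Qed.

Lemma lambda_max_invmx_le (K : realType) d (M : 'M[K]_d) : (0 < d)%N ->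
  spdmx M -> lambda_max (invmx M) <= (lambda_min M)^-1.
Proof.
move=> d0 Mspd; have [Isym Ipos] := invmx_spd Mspd.
have [ev _] := lambda_maxP d0 Isym.
have a_gt0 := spd_eigenvalue_gt0 (invmx_spd Mspd) ev.
have [ev' lb] := lambda_minP d0 Mspd.1.
have := eigenvalue_ge lb (eigenvalue_invmx (spd_unit Mspd) (lt0r_neq0 a_gt0) ev).
by move=> le;
  rewrite -[leLHS]invrK lef_pV2 ?posrE ?invr_gt0 ?(spd_eigenvalue_gt0 Mspd ev').
Qed.

(** * Spectral estimates for an inverse plus a positive semidefinite term *)

Lemma loewner_le_addZ (K : realType) d (S G : 'M[K]_d) a : (0 < d)%N ->
  G \is symmetricmx -> 0 <= a ->
  loewner_le (S + (a * lambda_min G) *: 1%:M) (S + a *: G) /\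
  loewner_le (S + a *: G) (S + (a * lambda_max G) *: 1%:M).
Proof.
move=> d0 Gsym a0; have [_ lb] := lambda_minP d0 Gsym.
have [_ ub] := lambda_maxP d0 Gsym; move/symmetricmxP: Gsym => Gsym.
split; rewrite /loewner_le opprD addrACA subrr add0r; split=> [|x].
- by apply/symmetricmxP; rewrite linearB !linearZ /= trmx1 Gsym.
- rewrite quadformD quadformN quadform_scalar quadformZ subr_ge0 -mulrA.
  exact: ler_wpM2l.
- by apply/symmetricmxP; rewrite linearB !linearZ /= trmx1 Gsym.
- rewrite quadformD quadformN quadform_scalar quadformZ subr_ge0 -mulrA.
  exact: ler_wpM2l.
Qed.

Lemma psd_lambda_min_ge0 (K : realType) d (G : 'M[K]_d) : (0 < d)%N ->
  psdmx G -> 0 <= lambda_min G.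
Proof.
move=> d0 [Gsym Gpos]; have [ev _] := lambda_minP d0 Gsym.
by apply: eigenvalue_ge ev => x; rewrite mul0r.
Qed.

Lemma lambda_min_gt0 (K : realType) d (M : 'M[K]_d) : (0 < d)%N ->
  spdmx M -> 0 < lambda_min M.
Proof.
move=> d0 Mspd; exact: spd_eigenvalue_gt0 Mspd (lambda_minP d0 Mspd.1).1.
Qed.

Lemma lambda_min_le_max (K : realType) d (M : 'M[K]_d) : (0 < d)%N ->
  M \is symmetricmx -> lambda_min M <= lambda_max M.
Proof.
move=> d0 Msym; exact: eigenvalue_le (lambda_maxP d0 Msym).2 _ (lambda_minP d0 Msym).1.
Qed.

(** The common source of the eigenvalue bounds and of the condition number
bound, obtained by adding the bounds on the two summands. *)
Lemma quadform_invmx_addZ (K : realType) d (S G : 'M[K]_d) a x : (0 < d)%N ->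
  spdmx S -> G \is symmetricmx -> 0 <= a ->
  ((lambda_max S)^-1 + a * lambda_min G) * normsq x
    <= quadform (invmx S + a *: G) x
    <= ((lambda_min S)^-1 + a * lambda_max G) * normsq x.
Proof.
move=> d0 Sspd Gsym a0; have Isym := invmx_sym Sspd.1.
rewrite quadformD quadformZ !mulrDl -!mulrA; apply/andP; split.
  apply: lerD; last exact/(ler_wpM2l a0)/(lambda_minP d0 Gsym).2.
  apply: le_trans _ ((lambda_minP d0 Isym).2 x).
  by rewrite ler_wpM2r ?normsq_ge0 // lambda_min_invmx_ge.
apply: lerD; last exact/(ler_wpM2l a0)/(lambda_maxP d0 Gsym).2.
apply: le_trans ((lambda_maxP d0 Isym).2 x) _.
by rewrite ler_wpM2r ?normsq_ge0 // lambda_max_invmx_le.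
Qed.

Lemma spd_add_psdZ (K : realType) d (S G : 'M[K]_d) a :
  spdmx S -> psdmx G -> 0 <= a -> spdmx (S + a *: G).
Proof.
move=> [/symmetricmxP Ssym Spos] [/symmetricmxP Gsym Gpos] a0; split=> [|x x0].
  by apply/symmetricmxP; rewrite linearD linearZ /= Ssym Gsym.
by rewrite quadformD quadformZ ltr_pwDl ?Spos // mulr_ge0.
Qed.

Lemma cond_number_ge1 (K : realType) d (M : 'M[K]_d) : (0 < d)%N ->
  spdmx M -> 1 <= cond_number M.
Proof.
move=> d0 Mspd; rewrite /cond_number ler_pdivlMr ?lambda_min_gt0 // mul1r.
exact: lambda_min_le_max Mspd.1.
Qed.

(** The lower bound on the smallest eigenvalue drops the nonnegative term
[a * lambda_min G], so that dividing by it amounts to multiplying by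
[lambda_max S]. *)
Lemma cond_number_invmx_addZ (K : realType) d (S G : 'M[K]_d) a : (0 < d)%N ->
  spdmx S -> psdmx G -> 0 <= a ->
  cond_number (invmx S + a *: G) <=
  cond_number S + a * lambda_max G * lambda_max S.
Proof.
move=> d0 Sspd Gpsd a0; set A := invmx S + a *: G.
have Aspd : spdmx A by apply: spd_add_psdZ => //; exact: invmx_spd.
have bnd x := quadform_invmx_addZ x d0 Sspd Gpsd.1 a0.
have smin_gt0 := lambda_min_gt0 d0 Sspd.
have smax_gt0 := lt_le_trans smin_gt0 (lambda_min_le_max d0 Sspd.1).
have Amax : lambda_max A <= (lambda_min S)^-1 + a * lambda_max G.
  by apply: eigenvalue_le (lambda_maxP d0 Aspd.1).1 => x; case/andP: (bnd x).
have Amin : (lambda_max S)^-1 <= lambda_min A.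
  apply: (@le_trans _ _ ((lambda_max S)^-1 + a * lambda_min G)).
    by rewrite lerDl mulr_ge0 // psd_lambda_min_ge0.
  by apply: eigenvalue_ge (lambda_minP d0 Aspd.1).1 => x; case/andP: (bnd x).
have Amax_ge0 : 0 <= lambda_max A.
  exact: le_trans (ltW (lambda_min_gt0 d0 Aspd)) (lambda_min_le_max d0 Aspd.1).
apply: (@le_trans _ _ (lambda_max A * lambda_max S)).
  rewrite /cond_number ler_wpM2l // -[leRHS]invrK lef_pV2 //.
    by rewrite posrE lambda_min_gt0.
  by rewrite posrE invr_gt0.
rewrite /cond_number (mulrC (lambda_max S)) -mulrDl.
by apply: ler_wpM2r Amax; exact: ltW.
Qed.

(** * The diffused prior covariance *)

Lemma Sigma_spd (K : realType) d (B : 'M[K]_d) t :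
  spdmx B -> t \in `[0, 1] -> spdmx (Sigma B t).
Proof.
move=> Bspd; rewrite in_itv /= => /andP[t0 t1]; split=> [|x x0].
  apply/symmetricmxP; rewrite linearD !linearZ /= trmx1.
  by move/symmetricmxP: Bspd.1 => ->.
rewrite quadformD quadformZ quadform_scalar /alpha /beta_sq.
have Bx := Bspd.2 x x0; have nx : 0 < normsq x by rewrite normsq_gt0.
(* The summand [t * normsq x] is positive except at [t = 0], where
   [Sigma B t] is [B] itself. *)
have [->|tn0] := eqVneq t 0; first by rewrite subr0 expr1n mul1r mul0r addr0.
apply: ltr_wpDl; first by rewrite mulr_ge0 ?sqr_ge0 ?(ltW Bx).
by rewrite mulr_gt0 // lt0r tn0.
Qed.

Lemma lambda_max_Sigma (K : realType) d (B : 'M[K]_d) t : (0 < d)%N ->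
  B \is symmetricmx ->
  lambda_max (Sigma B t) = alpha t ^+ 2 * lambda_max B + beta_sq t.
Proof. by move=> d0 Bsym; rewrite lambda_max_affine ?sqr_ge0. Qed.

Lemma lambda_min_Sigma (K : realType) d (B : 'M[K]_d) t : (0 < d)%N ->
  B \is symmetricmx ->
  lambda_min (Sigma B t) = alpha t ^+ 2 * lambda_min B + beta_sq t.
Proof. by move=> d0 Bsym; rewrite lambda_min_affine ?sqr_ge0. Qed.

(** After cross-multiplication the difference of the two sides is
[c * (q - p)]; this is why diffusion does not worsen the
conditioning of [B]. *)
Lemma ratio_shift_le (K : realFieldType) (p q a c : K) :
  0 < p -> p <= q -> 0 <= c -> 0 < a * p + c ->
  (a * q + c) / (a * p + c) <= q / p.
Proof.
move=> p0 pq c0 apc; rewrite ler_pdivrMr // mulrAC ler_pdivlMr //.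
rewrite -subr_ge0.
have -> : q * (a * p + c) - (a * q + c) * p = c * (q - p) by ring.
by rewrite mulr_ge0 // subr_ge0.
Qed.

Lemma Sigma0 (K : realType) d (B : 'M[K]_d) : Sigma B 0 = B.
Proof.
by rewrite /Sigma /alpha /beta_sq subr0 expr1n scale1r scale0r addr0.
Qed.

Lemma Sigma1 (K : realType) d (B : 'M[K]_d) : Sigma B 1 = 1%:M.
Proof.
by rewrite /Sigma /alpha /beta_sq subrr expr0n /= scale0r scale1r add0r.
Qed.

(** The upper function of the squeeze that gives the limit of the condition
number at [t = 1]. *)
Lemma cvg_cond_bound (K : realType) (p q g : K) (h : K -> K) :
  h t @[t --> 1^'-] --> (0 : K) ->
  (alpha t ^+ 2 * q + beta_sq t) / (alpha t ^+ 2 * p + beta_sq t) +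
    h t * g * (alpha t ^+ 2 * q + beta_sq t) @[t --> 1^'-] --> (1 : K).
Proof.
move=> h0.
have tcvg : t @[t --> (1 : K)^'-] --> (1 : K).
  by apply: cvg_at_left_filter; exact: cvg_id.
have alpha_cvg : alpha t @[t --> (1 : K)^'-] --> (0 : K).
  by rewrite -(subrr (1 : K)); apply: cvgB tcvg; exact: cvg_cst.
have s_cvg r : (alpha t ^+ 2 * r + beta_sq t) @[t --> (1 : K)^'-] --> (1 : K).
  rewrite -[X in _ --> X]add0r -(mul0r r) -[X in X * r](mul0r (0 : K)).
  by apply: cvgD tcvg; apply: cvgM (cvg_cst r); exact: (cvgM alpha_cvg alpha_cvg).
rewrite [X in _ --> X](_ : _ = 1 / 1 + 0 * g * 1); last first.
  by rewrite divr1 !mul0r addr0.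
apply: cvgD; first by apply: cvgM => //; apply: cvgV => //; exact: oner_neq0.
by apply: cvgM => //; apply: cvgM h0 (cvg_cst g).
Qed.

Theorem proposition3p3 (K : realType) (d m : nat)
    (B : 'M[K]_d) (R : 'M[K]_m) (H : 'M[K]_(m, d)) (h : K -> K)
    (d_gt0 : (0 < d)%N) (B_spd : spdmx B) (R_spd : spdmx R)
    (h_damping : damping h) :
  let G := obs_info R H in
  let A := post_curv B R H in
  let bmax := lambda_max B in
  let bmin := lambda_min B in
  (psdmx G /\ 0 < bmin <= bmax) /\
  (* endpoint consistency *)
  [/\ A_EnSF B R H h 0 = invmx B + H^T *m invmx R *m H,
      invmx B + H^T *m invmx R *m H = A,
      A_EnSF B R H h 1 = 1%:M,
      A_star B R H 0 = A
    & A_star B R H 1 = 1%:M] /\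
  (* two-sided spectral bounds *)
  (forall t : K, t \in `[0, 1] ->
    [/\ loewner_le (invmx (Sigma B t) + (h t * lambda_min G) *: 1%:M)
                   (A_EnSF B R H h t),
        loewner_le (A_EnSF B R H h t)
                   (invmx (Sigma B t) + (h t * lambda_max G) *: 1%:M)
      & forall a : K, eigenvalue (A_EnSF B R H h t) a ->
          1 / (alpha t ^+ 2 * bmax + beta_sq t) + h t * lambda_min G <= a /\
          a <= 1 / (alpha t ^+ 2 * bmin + beta_sq t) + h t * lambda_max G]) /\
  (* condition-number bound *)
  (forall t : K, t \in `[0, 1] ->
    [/\ cond_number (A_EnSF B R H h t) <=
          cond_number (Sigma B t) +
          h t * lambda_max G * (alpha t ^+ 2 * bmax + beta_sq t),
        cond_number (Sigma B t) =
          (alpha t ^+ 2 * bmax + beta_sq t) / (alpha t ^+ 2 * bmin + beta_sq t)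
      & (alpha t ^+ 2 * bmax + beta_sq t) / (alpha t ^+ 2 * bmin + beta_sq t)
          <= cond_number B]) /\
  (* the limit needs h to be continuous at the endpoint t = 1 *)
  (h t @[t --> 1^'-] --> (0 : K) ->
    cond_number (A_EnSF B R H h t) @[t --> 1^'-] --> (1 : K)).
Proof.
move=> G A bmax bmin; have [h_decr h0 h1] := h_damping.
have G_psd : psdmx G by exact/congruence_psd/spd_psd/invmx_spd.
have bmin_gt0 : 0 < bmin by exact: lambda_min_gt0.
have bmin_le : bmin <= bmax by exact: lambda_min_le_max B_spd.1.
have h_ge0 t : t \in `[0, 1] -> 0 <= h t.
  move=> t01; rewrite -h1; apply: h_decr => //; last by case/andP: (t01).
  by rewrite in_itv /= ler01 lexx.
have smax t : lambda_max (Sigma B t) = alpha t ^+ 2 * bmax + beta_sq t.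
  exact: lambda_max_Sigma B_spd.1.
have smin t : lambda_min (Sigma B t) = alpha t ^+ 2 * bmin + beta_sq t.
  exact: lambda_min_Sigma B_spd.1.
have cond t : cond_number (Sigma B t) =
    (alpha t ^+ 2 * bmax + beta_sq t) / (alpha t ^+ 2 * bmin + beta_sq t).
  by rewrite /cond_number smax smin.
have cond_le t : t \in `[0, 1] -> cond_number (A_EnSF B R H h t) <=
    cond_number (Sigma B t) +
    h t * lambda_max G * (alpha t ^+ 2 * bmax + beta_sq t).
  move=> t01; rewrite -smax; apply: cond_number_invmx_addZ (h_ge0 _ t01) => //.
  exact: Sigma_spd.
split; [by rewrite bmin_gt0|split; [split|split; [|split]]].
- by rewrite /A_EnSF Sigma0 h0 scale1r.
- by [].
- by rewrite /A_EnSF Sigma1 h1 scale0r addr0 invmx1.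
- by rewrite /A_star -/(Sigma _ _) Sigma0 invmxK.
- by rewrite /A_star -/(Sigma _ _) Sigma1 invmx1.
- move=> t t01.
  have [lo up] := loewner_le_addZ (invmx (Sigma B t)) d_gt0 G_psd.1 (h_ge0 _ t01).
  split=> // a ea; rewrite !div1r -smax -smin.
  have bnd x := quadform_invmx_addZ x d_gt0 (Sigma_spd B_spd t01) G_psd.1 (h_ge0 _ t01).
  split; [apply: eigenvalue_ge ea|apply: eigenvalue_le ea] => x;
    by case/andP: (bnd x).
- move=> t t01; split=> //; first exact: cond_le.
  have := lambda_min_gt0 d_gt0 (Sigma_spd B_spd t01); rewrite smin => s_gt0.
  by apply: ratio_shift_le => //; case/andP: t01.
- move=> h_cvg; have bound_cvg := cvg_cond_bound bmin bmax (lambda_max G) h_cvg.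
  have one_cvg : (fun=> 1) t @[t --> (1 : K)^'-] --> (1 : K) by exact: cvg_cst.
  apply: squeeze_cvgr one_cvg bound_cvg; near=> t.
  have t01 : t \in `[0, 1].
    rewrite in_itv /=; apply/andP; split; near: t.
      by apply: nbhs_left_ge; exact: ltr01.
    exact: nbhs_left_le.
  rewrite -cond cond_le // andbT; apply: cond_number_ge1 => //.
  apply: spd_add_psdZ G_psd (h_ge0 _ t01).
  exact/invmx_spd/Sigma_spd.
Unshelve. all: by end_near.
Qed.
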